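(* The Frobenius/nuclear hybrid norm $\|\cdot\|_{\mathrm{F/N}}$ is a quasi-norm on $\mathbb{R}^{m\times n}$. Moreover, it is the Schatten-$2/3$ quasi-norm: for every $X\in\mathbb{R}^{m\times n}$ and every integer $d\ge \mathrm{rank}(X)$ used in its definition, $$\|X\|_{\mathrm{F/N}}=\|X\|_{S_{2/3}}.$$
   Context: $\sigma_i(X)$ denotes the $i$-th singular value of $X\in\mathbb{R}^{m\times n}$. For $0<p<\infty$, $\|X\|_{S_p}=\left(\sum_{i=1}^{\min(m,n)}\sigma_i(X)^p\right)^{1/p}$. The nuclear norm is $\|X\|_*=\sum_i\sigma_i(X)$ and $\|\cdot\|_F$ is the Frobenius norm. Definition (Frobenius/nuclear hybrid norm). For $X\in\mathbb{R}^{m\times n}$ with $\mathrm{rank}(X)=r\le d$, $$\|X\|_{\mathrm{F/N}}:=\min\left\{\|U\|_*\|V\|_F : U\in\mathbb{R}^{m\times d},\ V\in\mathbb{R}^{n\times d},\ X=UV^T\right\}.$$ A function $N:\mathbb{R}^{m\times n}\to[0,\infty)$ is a quasi-norm if $N(X)=0$ only for $X=0$, $N(aX)=|a|N(X)$ for all $a\in\mathbb{R}$, and there is a constant $\beta\ge1$ with $N(X+Y)\le\beta(N(X)+N(Y))$ for all $X,Y$. *)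

(* Defs.v *)
From mathcomp Require Import all_boot all_order all_algebra polyrcf.
From mathcomp Require Import all_classical all_reals all_analysis.

Set Implicit Arguments.
Unset Strict Implicit.
Unset Printing Implicit Defensive.

Import Order.TTheory GRing.Theory Num.Theory.

Local Open Scope classical_set_scope.
Local Open Scope ring_scope.

(* The real eigenvalues of A, each repeated according to its algebraic
   multiplicity, in nonincreasing order ([rootsR] lists roots without
   repetition). For symmetric A there are exactly n of them. *)
Definition eigenvalues (R : realType) (n : nat) (A : 'M[R]_n) : seq R :=
  sort >=%R (flatten [seq nseq (mup a (char_poly A)) a
                     | a <- rootsR (char_poly A)]).

(* Indices start at 0: [singular_value X i] is sigma_(i+1)(X), the square root
   of the (i+1)-st largest eigenvalue of X^T X. The definition is meaningful
   for i < minn m n; the remaining eigenvalues of X^T X (when m < n) are 0. *)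
Definition singular_value (R : realType) (m n : nat) (X : 'M[R]_(m, n))
    (i : nat) : R :=
  Num.sqrt (nth 0 (eigenvalues (X^T *m X)) i).

Definition schatten (R : realType) (p : R) (m n : nat) (X : 'M[R]_(m, n)) : R :=
  (\sum_(i < minn m n) singular_value X i `^ p) `^ p^-1.

Definition nuclear_norm (R : realType) (m n : nat) (X : 'M[R]_(m, n)) : R :=
  \sum_(i < minn m n) singular_value X i.

Definition frobenius_norm (R : realType) (m n : nat) (X : 'M[R]_(m, n)) : R :=
  Num.sqrt (\sum_(i < m) \sum_(j < n) X i j ^+ 2).

Definition hybrid_values (R : realType) (m n d : nat) (X : 'M[R]_(m, n)) :
    set R :=
  [set v | exists (U : 'M[R]_(m, d)) (V : 'M[R]_(n, d)),
     X = U *m V^T /\ v = nuclear_norm U * frobenius_norm V].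

Definition is_minimum (R : realType) (A : set R) (v : R) : Prop :=
  A v /\ lbound A v.

(* [inf] serves as a total version of the minimum: it is the minimum of
   [hybrid_values d X] as soon as the latter exists, i.e. as soon as
   [is_minimum (hybrid_values d X) (hybrid_norm d X)]. *)
Definition hybrid_norm (R : realType) (m n d : nat) (X : 'M[R]_(m, n)) : R :=
  inf (hybrid_values d X).

Definition is_quasi_norm (R : realType) (m n : nat) (N : 'M[R]_(m, n) -> R) :
    Prop :=
  [/\ forall X, 0 <= N X,
      forall X, N X = 0 -> X = 0,
      forall (a : R) (X : 'M[R]_(m, n)), N (a *: X) = `|a| * N X &
      exists2 beta : R, 1 <= beta &
        forall X Y : 'M[R]_(m, n), N (X + Y) <= beta * (N X + N Y)].

(* Main.v *)
(* Let X = P diag(s) Q^T be a thin singular value decomposition, s > 0.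

   The value schatten (2/3) X is attained by U = P diag(s^(2/3)) E^T and
   V = Q diag(s^(1/3)) E^T, where E pads with zeros up to d columns.

   Lower bound: if X = U V^T, then u = P^T U and w = V^T Q satisfy
   u w = diag(s). Hence u has full row rank and a polar decomposition u = N W
   with N symmetric positive definite and W W^T = 1. Then
   N^-1 diag(s) = W w, and since (N^-1)_ii N_ii >= 1, Cauchy-Schwarz gives
   s_i <= N_ii |w_i| for the columns w_i of w. Hoelder's inequality with
   exponents 3/2 and 3 turns this into
   sum_i s_i^(2/3) <= (tr N)^(2/3) (sum_i |w_i|^2)^(1/3). Finally
   tr N = tr (P^T U W^T) <= |U|_* and sum_i |w_i|^2 <= |V|_F^2.

   The quasi-triangle inequality comes from concatenating optimal
   factorizations. *)
Require Import Defs.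
From mathcomp Require Import all_boot all_order all_algebra complex polyrcf.
From mathcomp Require Import all_classical all_reals all_analysis.
From mathcomp Require Import ring lra.

Set Implicit Arguments.
Unset Strict Implicit.
Unset Printing Implicit Defensive.

Import Order.TTheory GRing.Theory Num.Theory.

Local Open Scope ring_scope.

(** * Spectral theorem for real symmetric matrices *)

Lemma row_sqrE (R : rcfType) n (v : 'rV[R]_n) :
  v *m v^T = (\sum_j v 0 j ^+ 2)%:M.
Proof.
apply/matrixP => i j; rewrite !mxE (ord1 i) (ord1 j) eqxx mulr1n.
by apply: eq_bigr => k _; rewrite mxE expr2.
Qed.

Lemma sum_sqr_gt0 (R : rcfType) n (v : 'rV[R]_n) :
  v != 0 -> 0 < \sum_j v 0 j ^+ 2.
Proof.
move=> v0; rewrite lt_def sumr_ge0 ?andbT => [|j _]; last exact: sqr_ge0.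
apply: contra v0 => /eqP s0; apply/eqP/rowP => j; rewrite mxE; apply/eqP.
rewrite -sqrf_eq0; apply/eqP; move: s0 => /eqP.
rewrite psumr_eq0 => [/allP/(_ j)|k _]; last exact: sqr_ge0.
by rewrite mem_index_enum => /(_ isT)/eqP.
Qed.

(** Over the algebraically closed field of complex numbers over [R] there is an eigenvalue a + ib,
    with eigenvector x + iy. Symmetry forces b = 0, so x and y both satisfy the real eigenvector
    equation, and one of them is nonzero. *)
Lemma symmetric_eigenvector (R : rcfType) n (A : 'M[R]_n.+1) : A^T = A ->
  exists (a : R) (v : 'rV[R]_n.+1), v *m A = a *: v /\ v *m v^T = 1%:M.
Proof.
move=> symA.
suff [a [v [vA v0]]] : exists (a : R) (v :
  'rV[R]_n.+1), v *m A = a *: v /\ v != 0.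
  have p := sum_sqr_gt0 v0; set t := \sum_j _ in p.
  exists a, ((Num.sqrt t)^-1 *: v); split.
    by rewrite -scalemxAl vA !scalerA mulrC.
  rewrite linearZ /= -scalemxAr -scalemxAl row_sqrE -/t !scale_scalar_mx mulrA.
  by rewrite -invfM -expr2 sqr_sqrtr ?mulVf ?gt_eqF ?ltW.
have [[a b] /eigenvalueP[v vA v0]] :=
  eigenvalue_closed (map_mx (real_complex R) A) (ltn0Sn n).
pose x : 'rV[R]_n.+1 := map_mx (@complex.Re R) v.
pose y : 'rV[R]_n.+1 := map_mx (@complex.Im R) v.
have xA : x *m A = a *: x - b *: y.
  apply/rowP => j; move/rowP/(_ j)/(congr1 (@complex.Re R)): vA; rewrite !mxE.
  rewrite (big_morph (@complex.Re R) (id1 := 0) (op1 := +%R)) //;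
    last by case=> ? ? [].
  have -> : \sum_i x 0 i * A i j
    = \sum_i complex.Re (v 0 i * (map_mx (real_complex R) A) i j).
    by apply: eq_bigr => i _; rewrite !mxE; case: (v 0 i) => c d /=;
      rewrite mulr0 subr0.
  by move=> ->; case: (v 0 j) => c d /=.
have yA : y *m A = b *: x + a *: y.
  apply/rowP => j; move/rowP/(_ j)/(congr1 (@complex.Im R)): vA; rewrite !mxE.
  rewrite (big_morph (@complex.Im R) (id1 := 0) (op1 := +%R)) //;
    last by case=> ? ? [].
  have -> : \sum_i y 0 i * A i j
    = \sum_i complex.Im (v 0 i * (map_mx (real_complex R) A) i j).
    by apply: eq_bigr => i _; rewrite !mxE; case: (v 0 i) => c d /=;
      rewrite mulr0 add0r.
  by move=> ->; case: (v 0 j) => c d /=; rewrite addrC.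
have nz : 0 < \sum_j x 0 j ^+ 2 + \sum_j y 0 j ^+ 2.
  have px : 0 <= \sum_j x 0 j ^+ 2 by apply: sumr_ge0 => ? _; exact: sqr_ge0.
  have py : 0 <= \sum_j y 0 j ^+ 2 by apply: sumr_ge0 => ? _; exact: sqr_ge0.
  have [x0|/sum_sqr_gt0 x0] := eqVneq x 0; last exact: ltr_wpDr.
  have [y0|/sum_sqr_gt0 y0] := eqVneq y 0; last exact: ltr_wpDl.
  case/negP: v0; apply/eqP/rowP => j; rewrite mxE.
  move/rowP/(_ j): x0; move/rowP/(_ j): y0; rewrite !mxE.
  by case: (v 0 j) => c d /= -> ->.
(* Symmetry of A gives <xA, y> = <x, yA>, that is b (|x|^2 + |y|^2) = 0. *)
have b0 : b = 0.
  have := congr1 (fun M => M *m y^T) xA; rewrite mulmxBl -!scalemxAl.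
  rewrite -mulmxA.
  have -> : A *m y^T = (y *m A)^T by rewrite trmx_mul symA.
  rewrite yA linearD !linearZ /= mulmxDr.
  rewrite -!scalemxAr !row_sqrE => /(congr1 (fun M : 'M[R]_1 => M 0 0)).
  rewrite !mxE eqxx !mulr1n => e; apply/eqP.
  rewrite -(mulIr_eq0 b (mulIf (lt0r_neq0 nz))); apply/eqP; move: e.
  set s := \sum_i _; set t := \sum_i _; set w := \sum_i _; lra.
rewrite b0 scale0r subr0 in xA; rewrite b0 scale0r add0r in yA.
have [x0|x0] := eqVneq x 0; last by exists a, x.
exists a, y; split => //; apply: contraTneq nz => y0.
by rewrite x0 y0 !big1 ?addr0 ?ltxx // => i _; rewrite mxE expr0n.
Qed.

(* H is the Householder reflection exchanging v and the first basis vector. *)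
Lemma orthogonal_with_row0 (R : rcfType) n (v : 'rV[R]_n.+1) :
    v *m v^T = 1%:M ->
  exists2 H : 'M[R]_n.+1, H *m H^T = 1%:M & row 0 H = v.
Proof.
move=> v1; pose e : 'rV[R]_n.+1 := delta_mx 0 0.
have [->|ve] := eqVneq v e.
  by exists 1%:M; rewrite ?trmx1 ?mulmx1 // row1.
have [w wE] : exists w, w = v - e by exists (v - e).
have /sum_sqr_gt0 : w != 0 by rewrite wE subr_eq0.
have e1 : e *m e^T = 1%:M.
  by rewrite trmx_delta mul_delta_mx; apply/matrixP => i j;
    rewrite !mxE !ord1 !eqxx.
set t := \sum_j _ => t0.
have wwE : w *m w^T = t%:M by exact: row_sqrE.
(* Since v and e are unit vectors, t = |v - e|^2 = 2 - 2<e, v>, whence <e, w> = <e, v> - 1 = -t/2.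
   This makes the reflection along w send e to e + w = v. *)
have ewE : e *m w^T = (- t / 2)%:M.
  have [c cE] : exists c, e *m v^T = c%:M by eexists; exact: mx11_scalar.
  have veE : v *m e^T = c%:M by rewrite -[v]trmxK -trmx_mul cE tr_scalar_mx.
  move: wwE; rewrite wE linearB /= mulmxBl !mulmxBr v1 e1 cE veE.
  move=> /(congr1 (fun M : 'M[R]_1 => M 0 0)); rewrite !mxE eqxx !mulr1n => cE'.
  by rewrite -!raddfB /=; congr (_%:M); lra.
pose H := 1%:M - (2 / t) *: (w^T *m w).
have HT : H^T = H by rewrite /H linearB /= linearZ /= trmx1 trmx_mul trmxK.
have t0' : t != 0 by rewrite gt_eqF.
exists H.
  rewrite HT /H !mulmxBl !mulmxBr !mul1mx mulmx1 -!scalemxAl -!scalemxAr.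
  have -> : w^T *m w *m (w^T *m w) = t *: (w^T *m w).
    by rewrite mulmxA -(mulmxA _ w) wwE mul_mx_scalar scalemxAl.
  set W := w^T *m w; apply/matrixP => i j; rewrite !mxE; move: (W i j) => z.
  by field.
rewrite rowE -/e /H mulmxBr mulmx1 -scalemxAr mulmxA ewE mul_scalar_mx scalerA.
have -> : 2 / t * (- t / 2) = -1 by field.
by rewrite scaleN1r opprK wE addrC subrK.
Qed.

(** Induction on the size: conjugating by an orthogonal [H] whose first row is a unit eigenvector
    leaves only the eigenvalue in the first row. By symmetry the first column is of the same form,
    so the induction hypothesis applies to the remaining block. *)
Lemma spectral_symmetric (R : rcfType) n (A : 'M[R]_n) : A^T = A ->
  exists (O : 'M[R]_n) (l : 'rV[R]_n),
    O^T *m O = 1%:M /\ A = O *m diag_mx l *m O^T.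
Proof.
elim: n A => [|n IHn] A symA.
  exists 1%:M, 0; split; first by rewrite trmx1 mulmx1.
  by rewrite [LHS]flatmx0 [RHS]flatmx0.
have [a [v [vA v1]]] := symmetric_eigenvector symA.
have [H HH rH] := orthogonal_with_row0 v1.
pose B : 'M[R]_(1 + n) := H *m A *m H^T.
have symB : B^T = B by rewrite /B !trmx_mul trmxK symA mulmxA.
have rB : row (lshift n 0) B = a *: row (lshift n 0) 1%:M.
  have r0 : lshift n 0 = 0 :> 'I_(1 + n) by apply: val_inj.
  by rewrite r0 /B !row_mul rH vA -scalemxAl -rH -row_mul HH.
have Bur : ursubmx B = 0.
  apply/matrixP => i j; rewrite (ord1 i) !mxE.
  move/rowP/(_ (rshift 1 j)): rB; rewrite !mxE => ->.
  by rewrite eq_lrshift mulr0.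
have Bul : ulsubmx B = a%:M.
  apply/matrixP => i j; rewrite (ord1 i) (ord1 j) !mxE.
  move/rowP/(_ (lshift n 0)): rB; rewrite !mxE => ->.
  by rewrite !eqxx mulr1.
have Bdl : dlsubmx B = 0 by rewrite -symB -trmx_ursub Bur trmx0.
have [|K [l [KK drE]]] := IHn (drsubmx B); first by rewrite trmx_drsub symB.
pose L : 'M[R]_(1 + n) := block_mx 1%:M 0 0 K.
have LL : L^T *m L = 1%:M.
  rewrite /L tr_block_mx !trmx0 trmx1 mulmx_block !mulmx0 !mul0mx mulmx1 KK.
  by rewrite !addr0 !add0r -scalar_mx_block.
have BE : B = L *m diag_mx (row_mx a%:M l : 'rV_(1 + n)) *m L^T.
  have -> : diag_mx (row_mx a%:M l : 'rV_(1 + n))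
      = block_mx a%:M 0 0 (diag_mx l).
    rewrite diag_mx_row; congr block_mx.
    by apply/matrixP => i j; rewrite !mxE !ord1 eqxx.
  rewrite -[LHS]submxK Bur Bul Bdl drE /L tr_block_mx !trmx0 trmx1 !mulmx_block.
  by rewrite !mulmx0 !mul0mx !mulmx1 !mul1mx !addr0 !add0r !mul0mx.
exists (H^T *m L), (row_mx a%:M l : 'rV_(1 + n)); split.
  by rewrite trmx_mul trmxK mulmxA -(mulmxA _ H) HH mulmx1.
have HH' := mulmx1C HH.
rewrite trmx_mul trmxK; transitivity (H^T *m B *m H);
  last by rewrite BE !mulmxA.
by rewrite /B !mulmxA HH' mul1mx -mulmxA HH' mulmx1.
Qed.

(** * Singular values and the thin singular value decomposition *)

Lemma char_poly_orthogonal_diag (R : comUnitRingType) n (O : 'M[R]_n)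
    (l : 'rV[R]_n) :
  O^T *m O = 1%:M ->
  char_poly (O *m diag_mx l *m O^T) = \prod_(k < n) ('X - (l 0 k)%:P).
Proof.
move=> OO; have OOp : map_mx polyC O *m map_mx polyC O^T = 1%:M.
  by rewrite -map_mxM (mulmx1C OO) map_mx1.
have -> : char_poly (O *m diag_mx l *m O^T) = char_poly (diag_mx l).
  rewrite /char_poly /char_poly_mx !map_mxM.
  have XE : 'X%:M = map_mx polyC O *m 'X%:M *m map_mx polyC O^T
      :> 'M[{poly R}]_n.
    by rewrite scalar_mxC -mulmxA OOp mulmx1.
  rewrite {1}XE -mulmxBl -mulmxBr !det_mulmx mulrC mulrA -det_mulmx.
  by rewrite (mulmx1C OOp) det1 mul1r.
rewrite char_poly_trig; last by exact/diag_mx_is_trig.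
by apply: eq_bigr => k _; rewrite mxE eqxx mulr1n.
Qed.

(** Both lists contain each b as often as its multiplicity as a root of the characteristic
    polynomial. *)
Lemma perm_eigenvalues (R : realType) n (A : 'M[R]_n) (l : seq R) :
  char_poly A = \prod_(a <- l) ('X - a%:P) -> perm_eq (eigenvalues A) l.
Proof.
move=> cE; rewrite perm_sort; apply/allP => b _ /=; apply/eqP.
have p0 : char_poly A != 0 by rewrite monic_neq0 // char_poly_monic.
rewrite -(mu_prod_XsubC b l) -cE count_flatten -map_comp sumnE big_map.
under eq_bigr => a _ do rewrite /= count_nseq /=.
have [bin|bnin] := boolP (b \in rootsR (char_poly A)).
  rewrite (bigD1_seq b) //= ?uniq_roots // eqxx mul1n big1 ?addn0 //.
  by move=> a /negPf ->.
rewrite big1_seq ?(mupNroot) //.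
  by rewrite -(roots_on_rootsR p0) in bnin; move: bnin; rewrite in_itv.
by move=> a /= ain; case: eqVneq ain bnin => // -> ->.
Qed.

(** When m < n the left-hand sum omits the eigenvalues of index at least m. The list is
    nonincreasing and has only r <= m positive entries, so the omitted ones are nonpositive; their
    [Num.sqrt] is 0 and [f] vanishes there. *)
Lemma sum_singular_values (R : realType) m n r (X : 'M[R]_(m, n)) (l : seq R)
    (f : R -> R) :
  char_poly (X^T *m X) = \prod_(a <- l) ('X - a%:P) ->
  count (fun a => 0 < a) l = r -> (r <= m)%N -> f 0 = 0 ->
  \sum_(i < minn m n) f (singular_value X i) = \sum_(a <- l) f (Num.sqrt a).
Proof.
move=> cE lr rm f0; have pl := perm_eigenvalues cE.
rewrite -(perm_big _ pl) /= /singular_value.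
set s := eigenvalues _ in pl *.
have ss : sorted >=%R s by apply: sort_sorted; exact: ge_total.
have szs : size s = n.
  apply: succn_inj; rewrite (perm_size pl) -(size_char_poly (X^T *m X)) cE.
  by rewrite size_prod_XsubC.
rewrite (big_nth 0) szs -(big_mkord xpredT (fun i => f (Num.sqrt (nth 0 s i)))).
rewrite [RHS](@big_cat_nat _ _ _ (minn m n)) ?geq_minr //=.
rewrite [X in _ + X]big_nat_cond [X in _ + X]big1 ?addr0 // => i.
rewrite andbT geq_min => /andP[ge_i lt_i].
have mi : (m <= i)%N by case/orP: ge_i => //; rewrite leqNgt lt_i.
suff /ler0_sqrtr -> : nth 0 s i <= 0 by [].
rewrite leNgt; apply/negP => pos_i.
have : (i < count (fun a => 0 < a)%R s)%N.
  rewrite -[s](cat_take_drop i.+1) count_cat.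
  apply: leq_trans (leq_addr _ _).
  suff : all (fun a => 0 < a) (take i.+1 s).
    by rewrite all_count size_takel ?szs // => /eqP ->.
  apply/(all_nthP 0) => j; rewrite size_takel ?szs // => ji.
  rewrite nth_take //; apply: lt_le_trans pos_i _.
  apply: (sorted_leq_nth _ _ 0 ss) => //; rewrite ?inE ?szs //.
  - by move=> x y z /= yx zy; exact: le_trans zy yx.
  - by move=> x /=.
  - exact: leq_trans ji lt_i.
by rewrite (permP pl) lr ltnNge (leq_trans rm mi).
Qed.

Lemma orthonormal_cols_leq (F : fieldType) m r (P : 'M[F]_(m, r)) :
  P^T *m P = 1%:M -> (r <= m)%N.
Proof. by move=> PP; rewrite -(mxrank1 F r) -PP; exact: mulmx_max_rank. Qed.

(** If X^T X = O diag(l) O^T, the columns of X O are orthogonal with squared lengths l_k. Keeping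
    those with l_k > 0 and normalizing them gives P; the matching columns of O give Q. The last
    clause moves sums over singular values to [s] without matching indices. *)
Lemma thin_svd (R : realType) m n (X : 'M[R]_(m, n)) :
  exists r (P : 'M[R]_(m, r)) (Q : 'M[R]_(n, r)) (s : 'rV[R]_r),
    [/\ P^T *m P = 1%:M, Q^T *m Q = 1%:M, forall k, 0 < s 0 k,
        X = P *m diag_mx s *m Q^T &
        forall f : R -> R, f 0 = 0 ->
          \sum_(i < minn m n) f (singular_value X i) = \sum_k f (s 0 k)].
Proof.
have [|O [l [OO XE]]] := @spectral_symmetric R n (X^T *m X).
  by rewrite trmx_mul trmxK.
pose Y := X *m O.
have YY : Y^T *m Y = diag_mx l.
  rewrite /Y trmx_mul mulmxA -(mulmxA _ X^T) XE !mulmxA OO mul1mx.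
  by rewrite -mulmxA OO mulmx1.
have YYe i j : \sum_k Y k i * Y k j = l 0 i *+ (i == j).
  by move/matrixP/(_ i j): YY; rewrite !mxE => <-;
    under [RHS]eq_bigr do rewrite mxE.
(* Dropping the columns with l_k <= 0 loses nothing: their squared length is l_k, so they vanish. *)
have Y0 i k : ~~ (0 < l 0 k) -> Y i k = 0.
  rewrite -leNgt => lk; have := YYe k k; rewrite eqxx mulr1n => lE.
  apply/eqP; rewrite -sqrf_eq0 expr2.
  have ge0 j : true -> 0 <= Y j k * Y j k by rewrite -expr2 sqr_ge0.
  have := psumr_eq0 (index_enum 'I_m) ge0.
  have -> : \sum_j Y j k * Y j k == 0.
    by rewrite eq_le sumr_ge0 // lE lk.
  by move/esym/allP/(_ i); rewrite mem_index_enum => /(_ isT).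
pose S := [pred k | 0 < l 0 k]; pose e := @enum_val 'I_n S.
have eS j : 0 < l 0 (e j) by exact: (enum_valP j).
have ee i j : (e i == e j) = (i == j) by exact: (inj_eq enum_val_inj).
pose s := \row_j Num.sqrt (l 0 (e j)).
pose P := \matrix_(i, j) (Y i (e j) / s 0 j).
pose Q := \matrix_(i, j) O i (e j).
have sE j : s 0 j = Num.sqrt (l 0 (e j)) by rewrite mxE.
have PE i j : P i j = Y i (e j) / s 0 j by rewrite mxE.
have QE i j : Q i j = O i (e j) by rewrite mxE.
have s0 j : 0 < s 0 j by rewrite sE sqrtr_gt0.
have PP : P^T *m P = 1%:M.
  apply/matrixP => i j; rewrite !mxE.
  under eq_bigr => k _ do rewrite mxE !PE mulrACA.
  rewrite -mulr_suml YYe ee; case: eqVneq => [<-|_]; last by rewrite mul0r.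
  by rewrite !mulr1n sE -invfM -expr2 sqr_sqrtr ?ltW // divff ?gt_eqF.
exists #|S|, P, Q, s; split => //.
- apply/matrixP => i j; rewrite !mxE.
  under eq_bigr => k _ do rewrite mxE !QE.
  move/matrixP/(_ (e i) (e j)): OO; rewrite !mxE ee => <-.
  by apply: eq_bigr => k _; rewrite mxE.
- have -> : X = Y *m O^T by rewrite /Y -mulmxA (mulmx1C OO) mulmx1.
  apply/matrixP => i j; rewrite mul_mx_diag [LHS]mxE [RHS]mxE.
  rewrite (bigID S) /= [X in _ + X]big1 => [|k lk]; last by rewrite Y0 // mul0r.
  rewrite addr0 (big_enum_val (A := S)) /=; apply: eq_bigr => k _.
  by rewrite ![_^T _ _]mxE QE [X in _ = X * _]mxE PE divfK // gt_eqF.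
- move=> f f0; pose ls := [seq l 0 k | k <- index_enum 'I_n].
  have cE : char_poly (X^T *m X) = \prod_(a <- ls) ('X - a%:P).
    by rewrite XE char_poly_orthogonal_diag // big_map.
  have lr : count (fun a => 0 < a) ls = #|S|.
    by rewrite count_map -sum1_count sum1_card.
  rewrite (sum_singular_values cE lr (orthonormal_cols_leq PP) f0) big_map.
  rewrite (bigID S) /= [X in _ + X]big1 => [|k]; last first.
    by rewrite -leNgt => /ler0_sqrtr ->.
  rewrite addr0 (big_enum_val (A := S)) /=; apply: eq_bigr => k _.
  by rewrite sE.
Qed.

(** * Nuclear norm as a maximum of traces *)

Lemma cauchy_schwarz_sum (R : realFieldType) (I : finType) (a b : I -> R) :
  (\sum_i a i * b i) ^+ 2 <= (\sum_i a i ^+ 2) * \sum_i b i ^+ 2.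
Proof.
set S := \sum_i a i * b i; set A := \sum_i a i ^+ 2; set B := \sum_i b i ^+ 2.
have B0 : 0 <= B by apply: sumr_ge0 => i _; exact: sqr_ge0.
have [B0'|Bpos] := eqVneq B 0.
  suff -> : S = 0 by rewrite B0' mulr0 expr0n.
  apply: big1 => i _; apply/eqP; rewrite mulf_eq0; apply/orP; right.
  have := psumr_eq0 (index_enum I) (fun i (_ : true) => sqr_ge0 (b i)).
  rewrite -/B B0' eqxx => /esym/allP/(_ i); rewrite mem_index_enum.
  by move=> /(_ isT) /=; rewrite sqrf_eq0.
have {B0} Bpos : 0 < B by rewrite lt_def Bpos.
have : 0 <= \sum_i (B * a i - S * b i) ^+ 2.
  by apply: sumr_ge0 => i _; exact: sqr_ge0.
have -> : \sum_i (B * a i - S * b i) ^+ 2 = B * (A * B - S ^+ 2).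
  transitivity (\sum_i (B ^+ 2 * a i ^+ 2 - (2 * B * S) * (a i * b i)
                        + S ^+ 2 * b i ^+ 2)).
    by apply: eq_bigr => i _; ring.
  by rewrite big_split sumrB /= -!mulr_sumr -/A -/S -/B; ring.
by rewrite pmulr_rge0 // subr_ge0.
Qed.

(** The difference of the two sides is the squared length of column j of X - C C^T X, the residual
    of the orthogonal projection onto the columns of C. *)
Lemma bessel (R : realFieldType) m k p (C : 'M[R]_(m, k)) (X : 'M[R]_(m, p)) j :
  C^T *m C = 1%:M -> \sum_i (C^T *m X) i j ^+ 2 <= \sum_i X i j ^+ 2.
Proof.
move=> CC; have sqrE q (Y : 'M[R]_(q, p)) : \sum_i Y i j ^+ 2 = (Y^T *m Y) j j.
  by rewrite mxE; apply: eq_bigr => i _; rewrite mxE expr2.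
rewrite !sqrE -subr_ge0; pose Y := X - C *m (C^T *m X).
have -> : (X^T *m X) j j - ((C^T *m X)^T *m (C^T *m X)) j j = (Y^T *m Y) j j.
  have -> : Y^T *m Y = X^T *m X - (C^T *m X)^T *m (C^T *m X).
    have -> : Y^T = X^T - (C *m (C^T *m X))^T by rewrite /Y linearB.
    rewrite /Y !trmx_mul !trmxK mulmxBl !mulmxBr !mulmxA.
    by rewrite -(mulmxA _ C^T C) CC mulmx1 subrr subr0.
  by rewrite [RHS]mxE [X in _ = _ + X]mxE.
by rewrite -sqrE sumr_ge0 // => i _; exact: sqr_ge0.
Qed.

(** The trace is the sum of t_i times the inner product of the i-th columns of C^T P and D^T Q. By
    Bessel these columns have length at most 1, and 2ab <= a^2 + b^2 bounds the inner product by
    1. *)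
Lemma trace_svd_le (R : realFieldType) m n r k (P : 'M[R]_(m, r))
    (Q : 'M[R]_(n, r)) (t : 'rV[R]_r) (C : 'M[R]_(m, k)) (D : 'M[R]_(n, k)) :
  P^T *m P = 1%:M -> Q^T *m Q = 1%:M -> (forall i, 0 <= t 0 i) ->
  C^T *m C = 1%:M -> D^T *m D = 1%:M ->
  \tr (C^T *m (P *m diag_mx t *m Q^T) *m D) <= \sum_i t 0 i.
Proof.
move=> PP QQ t0 CC DD.
have col1 q (Y : 'M[R]_(q, r)) i : Y^T *m Y = 1%:M -> \sum_j Y j i ^+ 2 = 1.
  move=> /matrixP/(_ i i); rewrite !mxE eqxx mulr1n => <-.
  by apply: eq_bigr => j _; rewrite mxE expr2.
have -> : \tr (C^T *m (P *m diag_mx t *m Q^T) *m D)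
    = \sum_i t 0 i * \sum_j (C^T *m P) j i * (D^T *m Q) j i.
  have -> : C^T *m (P *m diag_mx t *m Q^T) *m D
      = (C^T *m P) *m diag_mx t *m (D^T *m Q)^T.
    by rewrite trmx_mul trmxK !mulmxA.
  rewrite mul_mx_diag /mxtrace.
  under eq_bigr => i _ do rewrite mxE.
  rewrite exchange_big /=; apply: eq_bigr => i _; rewrite mulr_sumr.
  by apply: eq_bigr => j _; rewrite mxE [(D^T *m Q)^T _ _]mxE mulrAC mulrC.
apply: ler_sum => i _; rewrite ler_piMr //.
apply: (@le_trans _ R (\sum_j ((C^T *m P) j i ^+ 2 + (D^T *m Q) j i ^+ 2) / 2)).
  by apply: ler_sum => j _; have := sqr_ge0 ((C^T *m P) j i - (D^T *m Q) j i);
    lra.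
rewrite -mulr_suml big_split /=.
have := bessel P i CC; rewrite col1 // => bP.
have := bessel Q i DD; rewrite col1 // => bQ.
by rewrite ler_pdivrMr // mul1r (lerD bP).
Qed.

(** The singular vectors attain the bound of [trace_le_nuclear_norm]. Together the two lemmas give a
    variational form of the nuclear norm, from which its triangle inequality follows. *)
Lemma nuclear_norm_trace (R : realType) m n (U : 'M[R]_(m, n)) :
  exists r (C : 'M[R]_(m, r)) (D : 'M[R]_(n, r)),
    [/\ C^T *m C = 1%:M, D^T *m D = 1%:M &
        nuclear_norm U = \tr (C^T *m U *m D)].
Proof.
have [r [P [Q [s [PP QQ s0 UE sE]]]]] := thin_svd U.
exists r, P, Q; split => //.
rewrite /nuclear_norm (sE id) // UE !mulmxA PP mul1mx.
by rewrite -mulmxA QQ mulmx1 mxtrace_diag.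
Qed.

Lemma trace_le_nuclear_norm (R : realType) m n k (U : 'M[R]_(m, n))
    (C : 'M[R]_(m, k)) (D : 'M[R]_(n, k)) :
  C^T *m C = 1%:M -> D^T *m D = 1%:M -> \tr (C^T *m U *m D) <= nuclear_norm U.
Proof.
move=> CC DD; have [r [P [Q [s [PP QQ s0 UE sE]]]]] := thin_svd U.
rewrite /nuclear_norm (sE id) // UE; apply: trace_svd_le => // i.
exact: ltW.
Qed.

(** Passing through traces avoids identifying the singular values of the product with the entries of
    [t], which may be unsorted or zero. *)
Lemma nuclear_norm_svd_le (R : realType) m n r (P : 'M[R]_(m, r))
    (Q : 'M[R]_(n, r)) (t : 'rV[R]_r) :
  P^T *m P = 1%:M -> Q^T *m Q = 1%:M -> (forall i, 0 <= t 0 i) ->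
  nuclear_norm (P *m diag_mx t *m Q^T) <= \sum_i t 0 i.
Proof.
move=> PP QQ t0; have [k [C [D [CC DD ->]]]] :=
  nuclear_norm_trace (P *m diag_mx t *m Q^T).
exact: trace_svd_le.
Qed.

Lemma nuclear_normD (R : realType) m n (U V : 'M[R]_(m, n)) :
  nuclear_norm (U + V) <= nuclear_norm U + nuclear_norm V.
Proof.
have [k [C [D [CC DD ->]]]] := nuclear_norm_trace (U + V).
by rewrite mulmxDr mulmxDl mxtraceD lerD // trace_le_nuclear_norm.
Qed.

Lemma nuclear_norm_ge0 (R : realType) m n (U : 'M[R]_(m, n)) :
    0 <= nuclear_norm U.
Proof. by apply: sumr_ge0 => i _; exact: sqrtr_ge0. Qed.

(** * Polar decomposition and Hölder's inequality *)

(* W is the polar factor of u, u W^T its positive part and K the inverse of the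
   latter. *)
Lemma polar_decomposition (R : rcfType) r d (u : 'M[R]_(r, d))
    (w : 'M[R]_(d, r)) (s : 'rV[R]_r) :
  u *m w = diag_mx s -> (forall i, 0 < s 0 i) ->
  exists (W : 'M[R]_(r, d)) (K : 'M[R]_r),
    [/\ W *m W^T = 1%:M, W = K *m u, forall i, 0 <= (u *m W^T) i i &
        forall i, 1 <= (u *m W^T) i i * K i i].
Proof.
move=> uw s0; have [|O [l [OO uuE]]] := @spectral_symmetric R r (u *m u^T).
  by rewrite trmx_mul trmxK.
have OO' := mulmx1C OO.
have O1 i : \sum_j O i j ^+ 2 = 1.
  move/matrixP/(_ i i): OO'; rewrite !mxE eqxx mulr1n => <-.
  by apply: eq_bigr => j _; rewrite mxE expr2.
have l0 k : 0 < l 0 k.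
  have -> : l 0 k = \sum_j (row k (O^T *m u)) 0 j ^+ 2.
    have : (O^T *m u) *m (O^T *m u)^T = diag_mx l.
      rewrite trmx_mul trmxK mulmxA -(mulmxA _ u) uuE !mulmxA OO mul1mx.
      by rewrite -mulmxA OO mulmx1.
    move/matrixP/(_ k k); rewrite [LHS]mxE mxE eqxx mulr1n => <-.
    by apply: eq_bigr => j _; rewrite [X in _ * X]mxE [in RHS]mxE expr2.
  (* A zero row k of O^T u would make row k of O^T diag(s) zero; as s > 0, column k of the
     orthogonal matrix O would vanish. *)
  apply: sum_sqr_gt0; apply/eqP => ku0.
  have : row k (O^T *m u *m w) = 0 by rewrite row_mul ku0 mul0mx.
  rewrite -mulmxA uw mul_mx_diag => /rowP ks.
  move/matrixP/(_ k k): OO; rewrite !mxE eqxx => /eqP.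
  rewrite big1 => [|j _]; first by rewrite eq_sym oner_eq0.
  have := ks j; rewrite !mxE => /eqP.
  by rewrite mulf_eq0 (gt_eqF (s0 j)) orbF => /eqP ->; rewrite mul0r.
pose c : 'rV[R]_r := \row_k Num.sqrt (l 0 k).
have cE k : c 0 k = Num.sqrt (l 0 k) by rewrite mxE.
have c0 k : 0 < c 0 k by rewrite cE sqrtr_gt0.
pose b : 'rV[R]_r := \row_k (c 0 k)^-1.
have bE k : b 0 k = (c 0 k)^-1 by rewrite mxE.
(* K is (u u^T)^(-1/2), so u (K u)^T is (u u^T)^(1/2). *)
pose K := O *m diag_mx b *m O^T.
have KT : K^T = K by rewrite /K !trmx_mul trmxK tr_diag_mx mulmxA.
have uKE : u *m (K *m u)^T = O *m diag_mx c *m O^T.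
  rewrite trmx_mul KT mulmxA uuE /K !mulmxA -(mulmxA _ O^T O) OO mulmx1.
  rewrite -(mulmxA O) mulmx_diag; congr (_ *m diag_mx _ *m _).
  apply/rowP => k; rewrite mxE bE cE -{1}(sqr_sqrtr (ltW (l0 k))).
  by rewrite expr2 mulfK // gt_eqF // sqrtr_gt0.
have diagE (a : 'rV[R]_r) i :
  (O *m diag_mx a *m O^T) i i = \sum_k a 0 k * O i k ^+ 2.
  rewrite mul_mx_diag mxE; apply: eq_bigr => k _; rewrite !mxE; ring.
exists (K *m u), K; split => //.
- rewrite -mulmxA uKE /K !mulmxA -(mulmxA _ O^T O) OO mulmx1 -(mulmxA O).
  rewrite mulmx_diag; have -> : \row_j (b 0 j * c 0 j) = const_mx 1.
    by apply/rowP => k; rewrite mxE bE mulVf ?gt_eqF // mxE.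
  by rewrite diag_const_mx mulmx1.
- by move=> i; rewrite uKE diagE sumr_ge0 // => k _;
    rewrite mulr_ge0 ?sqr_ge0 ?ltW.
- move=> i; rewrite uKE !diagE.
  (* Row i of O has length 1; each O_ik^2 is split as c_k^(1/2) O_ik times c_k^(-1/2) O_ik, so that
     the two square sums are the diagonal entries in question. *)
  have := cauchy_schwarz_sum (fun k => Num.sqrt (c 0 k) * O i k)
    (fun k => (Num.sqrt (c 0 k))^-1 * O i k).
  have sc k : Num.sqrt (c 0 k) != 0 by rewrite gt_eqF // sqrtr_gt0.
  have -> : \sum_k Num.sqrt (c 0 k) * O i k
                   * ((Num.sqrt (c 0 k))^-1 * O i k) = 1.
    rewrite -(O1 i); apply: eq_bigr => k _.
    by rewrite mulrACA divff // mul1r expr2.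
  rewrite expr1n => /le_trans; apply; rewrite le_eqVlt; apply/orP; left.
  apply/eqP; congr (_ * _); apply: eq_bigr => k _.
    by rewrite exprMn sqr_sqrtr // ltW.
  by rewrite bE exprMn exprVn sqr_sqrtr // ltW.
Qed.

(** Arithmetic-geometric mean inequality for p, p, q, with y bounded through its cube to avoid cube
    roots. It rests on (2p + q)^3 - 27 p^2 q = (p - q)^2 (8p + q). *)
Lemma amgm3 (R : realFieldType) (p q y : R) :
  0 <= p -> 0 <= q -> y ^+ 3 <= p ^+ 2 * q -> 3 * y <= 2 * p + q.
Proof.
move=> p0 q0 le3; rewrite leNgt; apply/negP => lt1.
have pq0 : 0 <= 2 * p + q by apply: addr_ge0 => //; exact: mulr_ge0.
have lt3 : (2 * p + q) ^+ 3 < (3 * y) ^+ 3.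
  by rewrite ltr_pXn2r // nnegrE (le_trans pq0 (ltW lt1)).
have : 0 <= (p - q) ^+ 2 * (8 * p + q).
  by apply: mulr_ge0; [exact: sqr_ge0 | apply: addr_ge0 => //; exact: mulr_ge0].
have -> : (p - q) ^+ 2 * (8 * p + q) = (2 * p + q) ^+ 3 - 27 * (p ^+ 2 * q)
  by ring.
have e : (3 * y) ^+ 3 = 27 * y ^+ 3 by ring.
move: lt3 le3; rewrite e; set A := y ^+ 3; set B := p ^+ 2 * q;
  set D := (_ + q) ^+ 3.
lra.
Qed.

(* Hölder's inequality with exponents 3/2 and 3, free of fractional powers. *)
Lemma holder_cube (R : realFieldType) (I : Type) (r : seq I) (a b x : I -> R) :
  (forall i, 0 <= a i) -> (forall i, 0 <= b i) -> (forall i, 0 <= x i) ->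
  (forall i, x i ^+ 3 <= a i ^+ 2 * b i) ->
  (\sum_(i <- r) x i) ^+ 3 <= (\sum_(i <- r) a i) ^+ 2 * \sum_(i <- r) b i.
Proof.
move=> a0 b0 x0 xab; elim: r => [|i r IH];
  first by rewrite !big_nil expr0n mulr0.
rewrite !big_cons.
have: 0 <= \sum_(j <- r) a j by exact: sumr_ge0.
have: 0 <= \sum_(j <- r) b j by exact: sumr_ge0.
have: 0 <= \sum_(j <- r) x j by exact: sumr_ge0.
move: IH (xab i) (a0 i) (b0 i) (x0 i).
move: (a i) (b i) (x i) (\sum_(j <- r) a j) (\sum_(j <- r) b j)
  (\sum_(j <- r) x j).
move=> a1 b1 x1 a2 b2 x2 h2 h1 a10 b10 x10 x20 b20 a20.
have e1 : 0 <= x1 ^+ 3 by exact: exprn_ge0.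
have e2 : 0 <= x2 ^+ 3 by exact: exprn_ge0.
(* The mixed terms of the expanded cube are matched with those of the right-hand side: for p = a1 a2
   b1 and q = a1^2 b2, p^2 q is (a1^2 b1)^2 (a2^2 b2). *)
have m1 : 3 * (x1 ^+ 2 * x2) <= 2 * (a1 * a2 * b1) + a1 ^+ 2 * b2.
  apply: amgm3; rewrite ?mulr_ge0 ?sqr_ge0 //.
  have -> : (x1 ^+ 2 * x2) ^+ 3 = (x1 ^+ 3 * x1 ^+ 3) * x2 ^+ 3 by ring.
  have -> : (a1 * a2 * b1) ^+ 2 * (a1 ^+ 2 * b2)
    = ((a1 ^+ 2 * b1) * (a1 ^+ 2 * b1)) * (a2 ^+ 2 * b2) by ring.
  exact: (ler_pM (mulr_ge0 e1 e1) e2 (ler_pM e1 e1 h1 h1) h2).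
have m2 : 3 * (x2 ^+ 2 * x1) <= 2 * (a2 * a1 * b2) + a2 ^+ 2 * b1.
  apply: amgm3; rewrite ?mulr_ge0 ?sqr_ge0 //.
  have -> : (x2 ^+ 2 * x1) ^+ 3 = (x2 ^+ 3 * x2 ^+ 3) * x1 ^+ 3 by ring.
  have -> : (a2 * a1 * b2) ^+ 2 * (a2 ^+ 2 * b1)
    = ((a2 ^+ 2 * b2) * (a2 ^+ 2 * b2)) * (a1 ^+ 2 * b1) by ring.
  exact: (ler_pM (mulr_ge0 e2 e2) e1 (ler_pM e2 e2 h2 h2) h1).
have -> : (x1 + x2) ^+ 3
  = x1 ^+ 3 + 3 * (x1 ^+ 2 * x2) + 3 * (x2 ^+ 2 * x1) + x2 ^+ 3 by ring.
have -> : (a1 + a2) ^+ 2 * (b1 + b2)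
  = a1 ^+ 2 * b1 + (2 * (a1 * a2 * b1) + a1 ^+ 2 * b2)
    + (2 * (a2 * a1 * b2) + a2 ^+ 2 * b1) + a2 ^+ 2 * b2 by ring.
by rewrite !lerD.
Qed.

(** * The Schatten-2/3 value as the minimum over factorizations *)

Lemma sqr_frobenius_norm (R : realType) m n (A : 'M[R]_(m, n)) :
  frobenius_norm A ^+ 2 = \sum_i \sum_j A i j ^+ 2.
Proof.
rewrite sqr_sqrtr // sumr_ge0 // => i _; rewrite sumr_ge0 // => j _.
exact: sqr_ge0.
Qed.

(** This is the square of the lower bound; squaring clears the outer exponent 3/2 and the root in
    the Frobenius norm. *)
Lemma schatten23_factor_le (R : realType) m n d r (U : 'M[R]_(m, d))
    (V : 'M[R]_(n, d)) (P : 'M[R]_(m, r)) (Q : 'M[R]_(n, r)) (s : 'rV[R]_r) :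
  P^T *m P = 1%:M -> Q^T *m Q = 1%:M -> (forall k, 0 < s 0 k) ->
  U *m V^T = P *m diag_mx s *m Q^T ->
  (\sum_k s 0 k `^ (2 / 3)) ^+ 3 <= nuclear_norm U ^+ 2 * frobenius_norm V ^+ 2.
Proof.
move=> PP QQ s0 UVE; pose u := P^T *m U; pose w := V^T *m Q.
have uw : u *m w = diag_mx s.
  rewrite /u /w !mulmxA -(mulmxA _ U) UVE !mulmxA PP mul1mx.
  by rewrite -mulmxA QQ mulmx1.
have [W [K [WW WE N0 NK]]] := polar_decomposition uw s0.
have trN : \sum_i (u *m W^T) i i <= nuclear_norm U.
  have := @trace_le_nuclear_norm _ _ _ _ U P W^T; rewrite trmxK => /(_ PP WW).
  by [].
have frV : \sum_i \sum_j w j i ^+ 2 <= frobenius_norm V ^+ 2.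
  rewrite sqr_frobenius_norm exchange_big [X in _ <= X]exchange_big /=.
  apply: ler_sum => j _; apply: le_trans (bessel V j QQ).
  by rewrite le_eqVlt; apply/orP; left; apply/eqP/eq_bigr => i _;
    rewrite -[w in LHS]trmxK mxE trmx_mul trmxK.
have sK i : s 0 i ^+ 2 <= (u *m W^T) i i ^+ 2 * \sum_j w j i ^+ 2.
  have KsE : K i i * s 0 i = \sum_j W i j * w j i.
    have : K *m diag_mx s = W *m w by rewrite -uw mulmxA -WE.
    by rewrite mul_mx_diag => /matrixP/(_ i i); rewrite !mxE.
  have := cauchy_schwarz_sum (W i) (fun j => w j i); rewrite -KsE.
  have -> : \sum_j W i j ^+ 2 = 1.
    move/matrixP/(_ i i): WW; rewrite !mxE eqxx mulr1n => <-.
    by apply: eq_bigr => j _; rewrite mxE expr2.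
  rewrite mul1r => le1.
  apply: le_trans (ler_wpM2l (sqr_ge0 _) le1).
  by rewrite exprMn mulrA -exprMn ler_peMl ?sqr_ge0 // exprn_ege1.
apply: (@le_trans _ _
  ((\sum_i (u *m W^T) i i) ^+ 2 * \sum_i \sum_j w j i ^+ 2)).
  (* Here x_i = s_i^(2/3), so x_i^3 = s_i^2 and the termwise hypothesis is [sK]. *)
  apply: holder_cube => // [i|i|i].
  - by apply: sumr_ge0 => j _; exact: sqr_ge0.
  - exact: powR_ge0.
  - rewrite -powR_mulrn ?powR_ge0 // -powRrM divfK // powR_mulrn //.
    exact: ltW.
have wge0 : 0 <= \sum_i \sum_j w j i ^+ 2.
  by apply: sumr_ge0 => i _; apply: sumr_ge0 => j _; exact: sqr_ge0.
have uge0 : 0 <= \sum_i (u *m W^T) i i by exact: sumr_ge0.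
by rewrite ler_pM ?sqr_ge0 // ler_sqr // nnegrE // nuclear_norm_ge0.
Qed.

Lemma schatten23E (R : realType) m n r (X : 'M[R]_(m, n)) (s : 'rV[R]_r) :
  (forall f : R -> R, f 0 = 0 ->
    \sum_(i < minn m n) f (singular_value X i) = \sum_k f (s 0 k)) ->
  schatten (2 / 3) X = (\sum_k s 0 k `^ (2 / 3)) `^ (3 / 2).
Proof.
move=> sE; rewrite /schatten (sE (fun x => x `^ (2 / 3))) ?invf_div //.
by rewrite powR0 // gt_eqF // divr_gt0.
Qed.

Lemma powR32_sqr (R : realType) (x : R) :
    0 <= x -> (x `^ (3 / 2)) ^+ 2 = x ^+ 3.
Proof.
by move=> x0; rewrite -powR_mulrn ?powR_ge0 // -powRrM divfK // powR_mulrn.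
Qed.

Lemma schatten23_le (R : realType) m n d (X : 'M[R]_(m, n)) (U : 'M[R]_(m, d))
    (V : 'M[R]_(n, d)) :
  X = U *m V^T -> schatten (2 / 3) X <= nuclear_norm U * frobenius_norm V.
Proof.
move=> XUV; have [r [P [Q [s [PP QQ s0 XE sE]]]]] := thin_svd X.
rewrite (schatten23E sE) -ler_sqr ?nnegrE ?powR_ge0 //; last first.
  by rewrite mulr_ge0 ?sqrtr_ge0 ?nuclear_norm_ge0.
rewrite powR32_sqr ?sumr_ge0 // => [|i _]; last exact: powR_ge0.
by rewrite exprMn; apply: schatten23_factor_le PP QQ s0 _; rewrite -XUV.
Qed.

Lemma sqr_frobenius_norm_diag (R : realType) n r d (Q : 'M[R]_(n, r))
    (t : 'rV[R]_r) (E : 'M[R]_(d, r)) :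
  Q^T *m Q = 1%:M -> E^T *m E = 1%:M ->
  frobenius_norm (Q *m diag_mx t *m E^T) ^+ 2 = \sum_k t 0 k ^+ 2.
Proof.
move=> QQ EE; set V := Q *m _ *m _.
have -> : frobenius_norm V ^+ 2 = \tr (V *m V^T).
  rewrite sqr_frobenius_norm; apply: eq_bigr => i _; rewrite mxE.
  by apply: eq_bigr => j _; rewrite [V^T _ _]mxE expr2.
have -> : V *m V^T = Q *m (diag_mx t *m diag_mx t *m Q^T).
  rewrite /V !trmx_mul trmxK tr_diag_mx !mulmxA -(mulmxA _ E^T) EE mulmx1.
  by [].
rewrite mxtrace_mulC -(mulmxA _ Q^T) QQ mulmx1 mulmx_diag mxtrace_diag.
by apply: eq_bigr => k _; rewrite mxE expr2.
Qed.

(** The exponents 2/3 and 1/3 balance the factors: the same x = sum_k s_k^(2/3) bounds the nuclear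
    norm of U and equals the squared Frobenius norm of V. This common x is what makes concatenated
    factorizations comparable later. *)
Lemma schatten23_attained (R : realType) m n d (X : 'M[R]_(m, n)) :
  (\rank X <= d)%N ->
  exists (U : 'M[R]_(m, d)) (V : 'M[R]_(n, d)) (x : R),
    [/\ X = U *m V^T, nuclear_norm U <= x, frobenius_norm V ^+ 2 = x, 0 <= x &
        schatten (2 / 3) X = x `^ (3 / 2)].
Proof.
have [r [P [Q [s [PP QQ s0 XE sE]]]]] := thin_svd X => Xd.
(* P^T X Q = diag(s) is invertible of size r, so X has rank at least r. *)
have rd : (r <= d)%N.
  apply: leq_trans Xd; have PXQ : P^T *m X *m Q = diag_mx s.
    by rewrite XE !mulmxA PP mul1mx -mulmxA QQ mulmx1.
  have <- : \rank (diag_mx s) = r.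
    by apply: mxrank_unit; rewrite unitmxE det_diag unitfE;
      apply/prodf_neq0 => k _; rewrite gt_eqF.
  by rewrite -PXQ; apply: leq_trans (mxrankM_maxl _ _) (mxrankM_maxr _ _).
pose E : 'M[R]_(d, r) := pid_mx r.
have EE : E^T *m E = 1%:M.
  by rewrite tr_pid_mx mul_pid_mx minnn (minn_idPr rd) pid_mx_1.
pose t : 'rV[R]_r := \row_k s 0 k `^ (2 / 3).
pose q : 'rV[R]_r := \row_k s 0 k `^ (1 / 3).
exists (P *m diag_mx t *m E^T), (Q *m diag_mx q *m E^T).
exists (\sum_k s 0 k `^ (2 / 3)).
split.
- rewrite XE !trmx_mul trmxK tr_diag_mx !mulmxA -(mulmxA _ E^T) EE mulmx1.
  rewrite -[in RHS](mulmxA P) mulmx_diag; congr (_ *m diag_mx _ *m _).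
  apply/rowP => k; rewrite !mxE -powRD; last by rewrite (gt_eqF (s0 k)) implybT.
  by rewrite (_ : 2 / 3 + 1 / 3 = 1); [rewrite powRr1 ?ltW | field].
- apply: le_trans (nuclear_norm_svd_le PP EE _) _ => [k|].
    by rewrite mxE powR_ge0.
  by under eq_bigr do rewrite mxE.
- rewrite sqr_frobenius_norm_diag //; apply: eq_bigr => k _.
  by rewrite mxE -powR_mulrn ?powR_ge0 // -powRrM mulrAC mul1r.
- by apply: sumr_ge0 => k _; exact: powR_ge0.
- exact: schatten23E.
Qed.

Lemma schatten23_is_minimum (R : realType) m n d (X : 'M[R]_(m, n)) :
  (\rank X <= d)%N -> is_minimum (hybrid_values d X) (schatten (2 / 3) X).
Proof.
move=> Xd; have lb : lbound (hybrid_values d X) (schatten (2 / 3) X).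
  by move=> _ [U [V [XUV ->]]]; exact: schatten23_le.
split => //; have [U [V [x [XUV Ux Vx x0 sX]]]] := schatten23_attained Xd.
exists U, V; split => //; apply/eqP; rewrite eq_le schatten23_le //=.
rewrite sX -ler_sqr ?nnegrE ?powR_ge0 ?mulr_ge0 ?nuclear_norm_ge0 ?sqrtr_ge0 //.
rewrite powR32_sqr // exprMn Vx (exprSr x) ler_wpM2r //.
by rewrite ler_sqr ?nnegrE ?nuclear_norm_ge0.
Qed.

Lemma is_minimum_inf (R : realType) (A : set R) v : is_minimum A v -> inf A = v.
Proof.
move=> [Av lbv]; apply/eqP; rewrite eq_le ge_inf //=; last by exists v.
by rewrite lb_le_inf //; exists v.
Qed.

Lemma hybrid_normE (R : realType) m n d (X : 'M[R]_(m, n)) :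
  (\rank X <= d)%N -> hybrid_norm d X = schatten (2 / 3) X.
Proof. by move=> Xd; exact: is_minimum_inf (schatten23_is_minimum Xd). Qed.

(** * Quasi-norm properties *)

Lemma frobenius_normZ (R : realType) m n (a : R) (A : 'M[R]_(m, n)) :
  frobenius_norm (a *: A) = `|a| * frobenius_norm A.
Proof.
rewrite /frobenius_norm -sqrtr_sqr -sqrtrM ?sqr_ge0 // mulr_sumr.
congr Num.sqrt; apply: eq_bigr => i _; rewrite mulr_sumr; apply: eq_bigr => j _.
by rewrite mxE exprMn.
Qed.

(** An optimal factorization U V^T of X yields the factorization U (aV)^T of aX. Applying the
    inequality to the inverse scalar later gives equality. *)
Lemma schatten23Z_le (R : realType) m n (a : R) (X : 'M[R]_(m, n)) :
  schatten (2 / 3) (a *: X) <= `|a| * schatten (2 / 3) X.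
Proof.
have [[U [V [XUV ->]]] _] := schatten23_is_minimum (leqnn (\rank X)).
rewrite mulrCA -frobenius_normZ; apply: schatten23_le.
by rewrite [in LHS]XUV linearZ /= scalemxAr.
Qed.

Lemma schatten23_ge0 (R : realType) m n (X : 'M[R]_(m, n)) :
    0 <= schatten (2 / 3) X.
Proof. exact: powR_ge0. Qed.

Lemma schatten23Z (R : realType) m n (a : R) (X : 'M[R]_(m, n)) :
  schatten (2 / 3) (a *: X) = `|a| * schatten (2 / 3) X.
Proof.
apply/eqP; rewrite eq_le schatten23Z_le /=.
have [->|a0] := eqVneq a 0; first by rewrite normr0 mul0r schatten23_ge0.
rewrite -ler_pdivlMl ?normr_gt0 // -normfV.
have {1}-> : X = a^-1 *: (a *: X) by rewrite scalerA mulVf // scale1r.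
exact: schatten23Z_le.
Qed.

Lemma schatten23_eq0 (R : realType) m n (X : 'M[R]_(m, n)) :
  schatten (2 / 3) X = 0 -> X = 0.
Proof.
have [r [P [Q [s [PP QQ s0 XE sE]]]]] := thin_svd X.
rewrite (schatten23E sE) => /eqP; rewrite powR_eq0 => /andP[+ _].
rewrite psumr_eq0 => [/allP sk|k _]; last exact: powR_ge0.
(* A vanishing sum of positive terms has no terms, so this holds vacuously. *)
have s00 : s = 0.
  apply/rowP => k; have := sk k; rewrite mem_index_enum => /(_ isT) /=.
  by rewrite powR_eq0 (gt_eqF (s0 k)).
by rewrite XE s00 (raddf0 (@diag_mx R r)) mulmx0 mul0mx.
Qed.

(** If U = P diag(s) Q^T, then U E^T = P diag(s) (E Q)^T, and E Q again has orthonormal columns. *)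
Lemma nuclear_norm_isometry_le (R : realType) m n k (U : 'M[R]_(m, n))
    (E : 'M[R]_(k, n)) :
  E^T *m E = 1%:M -> nuclear_norm (U *m E^T) <= nuclear_norm U.
Proof.
move=> EE; have [r [P [Q [s [PP QQ s0 UE sE]]]]] := thin_svd U.
rewrite {2}/nuclear_norm (sE id) // UE -mulmxA -trmx_mul.
apply: nuclear_norm_svd_le => // [|i]; last exact: ltW.
by rewrite trmx_mul mulmxA -(mulmxA _ E^T) EE mulmx1.
Qed.

(** Each block is padded with zeros by an isometry, and the triangle inequality is applied to the
    sum. *)
Lemma nuclear_norm_row_mx_le (R : realType) m n1 n2 (U1 : 'M[R]_(m, n1))
    (U2 : 'M[R]_(m, n2)) :
  nuclear_norm (row_mx U1 U2) <= nuclear_norm U1 + nuclear_norm U2.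
Proof.
have -> : row_mx U1 U2 = U1 *m (col_mx 1%:M 0)^T + U2 *m (col_mx 0 1%:M)^T.
  rewrite !tr_col_mx !trmx1 !trmx0 !mul_mx_row !mulmx1 !mulmx0 add_row_mx.
  by rewrite addr0 add0r.
apply: le_trans (nuclear_normD _ _) _.
by apply: lerD; apply: nuclear_norm_isometry_le;
  rewrite tr_col_mx trmx1 trmx0 mul_row_col !mulmx1 !mulmx0 ?addr0 ?add0r.
Qed.

Lemma sqr_frobenius_norm_row_mx (R : realType) m n1 n2
    (A : 'M[R]_(m, n1)) (B : 'M[R]_(m, n2)) :
  frobenius_norm (row_mx A B) ^+ 2
    = frobenius_norm A ^+ 2 + frobenius_norm B ^+ 2.
Proof.
rewrite !sqr_frobenius_norm -big_split; apply: eq_bigr => i _.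
rewrite big_split_ord /=; congr (_ + _); apply: eq_bigr => j _.
  by rewrite row_mxEl.
by rewrite row_mxEr.
Qed.

(* Concatenating optimal factorizations with |U|_* <= |V|_F^2 = x gives a
   factorization of X + Y of value at most (x + y)^(3/2). *)
Lemma schatten23D_le (R : realType) m n (X Y : 'M[R]_(m, n)) :
  schatten (2 / 3) (X + Y) <=
  2 `^ (3 / 2) * (schatten (2 / 3) X + schatten (2 / 3) Y).
Proof.
have [U [V [x [XUV Ux Vx x0 ->]]]] := schatten23_attained (leqnn (\rank X)).
have [U' [V' [y [YUV Uy Vy y0 ->]]]] := schatten23_attained (leqnn (\rank Y)).
apply: (@le_trans _ _ ((x + y) `^ (3 / 2))).
  have /schatten23_le le1 : X + Y = row_mx U U' *m (row_mx V V')^T.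
    by rewrite tr_row_mx mul_row_col -XUV -YUV.
  apply: (le_trans le1); set W := row_mx V V' in le1 *.
  rewrite -ler_sqr ?nnegrE ?powR_ge0 ?mulr_ge0 ?nuclear_norm_ge0 ?sqrtr_ge0 //.
  rewrite powR32_sqr ?addr_ge0 // exprMn sqr_frobenius_norm_row_mx Vx Vy
    (exprSr (x + y)).
  rewrite ler_wpM2r ?addr_ge0 // ler_sqr ?nnegrE ?addr_ge0 ?nuclear_norm_ge0 //.
  by apply: le_trans (nuclear_norm_row_mx_le _ _) (lerD Ux Uy).
(* The constant comes from x + y <= 2 max(x, y), raised to the power 3/2. *)
wlog xy : x y x0 y0 {Ux Vx Uy Vy} / x <= y => [hw|].
  have [xy|/ltW yx] := leP x y; first exact: hw.
  by rewrite (addrC x) (addrC (x `^ _)); exact: hw.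
apply: (@le_trans _ _ ((2 * y) `^ (3 / 2))).
  rewrite ge0_ler_powR ?nnegrE ?addr_ge0 ?mulr_ge0 //.
  by rewrite mulr_natl mulr2n lerD2r.
by rewrite powRM // ler_wpM2l ?powR_ge0 // lerDr powR_ge0.
Qed.

Theorem theorem1 (R : realType) (m n : nat) :
  (forall d : 'M[R]_(m, n) -> nat,
     (forall X : 'M[R]_(m, n), (\rank X <= d X)%N) ->
     is_quasi_norm (fun X : 'M[R]_(m, n) => hybrid_norm (d X) X)) /\
  (forall (X : 'M[R]_(m, n)) (d : nat), (\rank X <= d)%N ->
     is_minimum (hybrid_values d X) (hybrid_norm d X) /\
     hybrid_norm d X = schatten (2 / 3) X).
Proof.
split=> [d dP|X d Xd]; last first.
  by rewrite hybrid_normE //; split=> //; exact: schatten23_is_minimum.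
(* X, Y and X + Y may use different inner dimensions; [hybrid_normE] removes this dependence,
   leaving the properties of the Schatten-2/3 value. *)
split.
- by move=> X; rewrite hybrid_normE // schatten23_ge0.
- by move=> X; rewrite hybrid_normE //; exact: schatten23_eq0.
- by move=> a X; rewrite !hybrid_normE // schatten23Z.
- exists (2 `^ (3 / 2)) => [|X Y]; last first.
    by rewrite !hybrid_normE // schatten23D_le.
  by rewrite -[leLHS](powRr0 2) ler_powR ?ler1n ?divr_ge0.
Qed.
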